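(* Let $\mathrm{S}\colon[0,1]^2\to[0,1]$ be a semicopula. (i) For every measurable space $(X,\mathcal{A})$, every capacity $\mu$ on $\mathcal{A}$, every $\mathcal{A}$-measurable function $f\colon X\to[0,1]$ and every sequence $(f_n)_{n=1}^\infty$ of $\mathcal{A}$-measurable functions $f_n\colon X\to[0,1]$: if $(f_n)$ converges strictly in $\mu$ to $f$, then $(f_n)$ converges in mean to $f$ with respect to the integral $\mathbf{I}_{\mathrm{S}}$. (ii) The converse implication does not hold: there exist a measurable space $(X,\mathcal{A})$, a capacity $\mu$ on $\mathcal{A}$, and $\mathcal{A}$-measurable functions $f,f_n\colon X\to[0,1]$ ($n\ge1$) such that $(f_n)$ converges in mean to $f$ with respect to $\mathbf{I}_{\mathrm{S}}$ but $(f_n)$ does not converge strictly in $\mu$ to $f$.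
   Context: A measurable space $(X,\mathcal{A})$ consists of a non-empty set $X$ and a $\sigma$-algebra $\mathcal{A}$ of subsets of $X$. A capacity on $\mathcal{A}$ is a set function $\mu\colon\mathcal{A}\to[0,1]$ that is non-decreasing ($A\subseteq B$ implies $\mu(A)\le\mu(B)$) with $\mu(\emptyset)=0$ and $\mu(X)=1$; no additivity or continuity is assumed. A semicopula is a function $\mathrm{S}\colon[0,1]^2\to[0,1]$ that is non-decreasing in each coordinate and has neutral element $1$, i.e. $\mathrm{S}(x,1)=\mathrm{S}(1,x)=x$ for all $x\in[0,1]$. For a semicopula $\mathrm{S}$, a capacity $\mu$ on $\mathcal{A}$ and an $\mathcal{A}$-measurable function $g\colon X\to[0,1]$, the generalized Sugeno integral (seminormed fuzzy integral) is $$\mathbf{I}_{\mathrm{S}}(\mu,g)=\sup_{t\in[0,1]}\mathrm{S}\big(t,\mu(\{g\ge t\})\big),\qquad \{g\ge t\}=\{x\in X: g(x)\ge t\}.$$ Let $f,f_n\colon X\to[0,1]$ be $\mathcal{A}$-measurable. The sequence $(f_n)_{n=1}^\infty$ converges strictly in $\mu$ to $f$ if $\lim_{n\to\infty}\mu(\{|f_n-f|>0\})=0$, where $\{|f_n-f|>0\}=\{x\in X:|f_n(x)-f(x)|>0\}$. It converges in mean to $f$ with respect to $\mathbf{I}_{\mathrm{S}}$ if $\lim_{n\to\infty}\mathbf{I}_{\mathrm{S}}(\mu,|f_n-f|)=0$. *)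

(* Defs.v *)
From mathcomp Require Export all_boot all_order all_algebra.
From mathcomp Require Export all_classical all_reals all_analysis.
Export numFieldNormedType.Exports.
Set Implicit Arguments.
Unset Strict Implicit.
Unset Printing Implicit Defensive.
Import Order.TTheory GRing.Theory Num.Theory.
Local Open Scope classical_set_scope.
Local Open Scope ring_scope.

(* A map on [0,1]^2 is represented by a function R -> R -> R; its values
   outside the unit square are unconstrained and never used. *)
Record semicopula (R : realType) (S : R -> R -> R) : Prop := Semicopula {
  semicopula_range : forall x y : R, x \in `[0, 1] -> y \in `[0, 1] ->
    S x y \in `[0, 1] ;
  semicopula_le_l : forall x x' y : R, x \in `[0, 1] -> x' \in `[0, 1] ->
    y \in `[0, 1] -> x <= x' -> S x y <= S x' y ;
  semicopula_le_r : forall x y y' : R, x \in `[0, 1] -> y \in `[0, 1] ->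
    y' \in `[0, 1] -> y <= y' -> S x y <= S x y' ;
  semicopula_x1 : forall x : R, x \in `[0, 1] -> S x 1 = x ;
  semicopula_1x : forall x : R, x \in `[0, 1] -> S 1 x = x }.

(* Likewise, the values of mu on non-measurable sets are irrelevant. *)
Record capacity (d : measure_display) (T : measurableType d) (R : realType)
    (mu : set T -> R) : Prop := Capacity {
  capacity_range : forall A, measurable A -> mu A \in `[0, 1] ;
  capacity_le : forall A B, measurable A -> measurable B -> A `<=` B ->
    mu A <= mu B ;
  capacity_set0 : mu set0 = 0 ;
  capacity_setT : mu setT = 1 }.

Definition measurable_unit (d : measure_display) (T : measurableType d)
    (R : realType) (g : T -> R) : Prop :=
  measurable_fun [set: T] g /\ forall x, g x \in `[0, 1].

Definition sugeno_integral (d : measure_display) (T : measurableType d)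
    (R : realType) (S : R -> R -> R) (mu : set T -> R) (g : T -> R) : R :=
  sup [set S t (mu [set x | t <= g x]) | t in `[0, 1]].

Definition cvg_strictly (d : measure_display) (T : measurableType d)
    (R : realType) (mu : set T -> R) (f_ : nat -> T -> R) (f : T -> R) : Prop :=
  mu [set x | 0 < `|f_ n x - f x|] @[n --> \oo] --> (0 : R).

Definition cvg_in_mean (d : measure_display) (T : measurableType d)
    (R : realType) (S : R -> R -> R) (mu : set T -> R)
    (f_ : nat -> T -> R) (f : T -> R) : Prop :=
  sugeno_integral S mu (fun x => `|f_ n x - f x|) @[n --> \oo] --> (0 : R).

(* Main.v *)
Require Import Defs.
Set Implicit Arguments.
Unset Strict Implicit.
Unset Printing Implicit Defensive.
Import Order.TTheory GRing.Theory Num.Theory.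
Local Open Scope classical_set_scope.
Local Open Scope ring_scope.

(** The integral of [g] is controlled from two sides of the unit square.
    For [t > 0] the level set [{g >= t}] lies in the support [{g > 0}], so
    [S t (mu {g >= t}) <= S 1 (mu {g > 0}) = mu {g > 0}]; hence
    [I_S(mu, g) <= mu {g > 0}], and strict convergence forces convergence in
    mean by squeezing ([sugeno_integral_le_support]).
    On the other hand [S t _ <= S t 1 = t], and level sets above a bound of [g]
    are empty, so [I_S(mu, g) <= sup g] ([sugeno_integral_le_bound]): uniform
    convergence also forces convergence in mean.  The positive constants
    [1/(n+1)] tend to [0] uniformly, yet each of them differs from [0] on
    the whole space, which has capacity [1]: this refutes the converse, for
    every semicopula at once. *)

Lemma semicopula_le_arg1 (R : realType) (S : R -> R -> R) (t y : R) :
  semicopula S -> t \in `[0, 1] -> y \in `[0, 1] -> S t y <= t.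
Proof.
move=> hS t01 y01; rewrite -[leRHS](semicopula_x1 hS t01).
apply: (semicopula_le_r hS) => //; first by rewrite in_itv /= ler01 lexx.
by move: y01; rewrite in_itv => /andP[].
Qed.

Lemma semicopula_le_arg2 (R : realType) (S : R -> R -> R) (t y : R) :
  semicopula S -> t \in `[0, 1] -> y \in `[0, 1] -> S t y <= y.
Proof.
move=> hS t01 y01; rewrite -[leRHS](semicopula_1x hS y01).
apply: (semicopula_le_l hS) => //; first by rewrite in_itv /= ler01 lexx.
by move: t01; rewrite in_itv => /andP[].
Qed.

Section sugeno_bounds.
Context (R : realType) (S : R -> R -> R) (hS : semicopula S).
Context (d : measure_display) (T : measurableType d) (mu : set T -> R).
Context (hmu : capacity mu).

Lemma measurable_level_set (g : T -> R) (t : R) :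
  measurable_fun [set: T] g -> measurable [set x | t <= g x].
Proof.
move=> mg; rewrite -[X in measurable X]setTI.
rewrite (_ : [set x | _] = g @^-1` `[t, +oo[); first exact: mg.
by apply/seteqP; split => x /=; rewrite in_itv /= andbT.
Qed.

Lemma measurable_support_set (g : T -> R) :
  measurable_fun [set: T] g -> measurable [set x | 0 < g x].
Proof.
move=> mg; rewrite -[X in measurable X]setTI.
rewrite (_ : [set x | _] = g @^-1` `]0, +oo[); first exact: mg.
by apply/seteqP; split => x /=; rewrite in_itv /= andbT.
Qed.

Lemma capacity_level_set (g : T -> R) (t : R) :
  measurable_fun [set: T] g -> mu [set x | t <= g x] \in `[0, 1].
Proof. by move=> mg; apply: (capacity_range hmu); exact: measurable_level_set. Qed.

Lemma sugeno_integral_ge0 (g : T -> R) :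
  measurable_fun [set: T] g -> 0 <= sugeno_integral S mu g.
Proof.
move=> mg.
have i0 : (0 : R) \in `[0, 1] by rewrite in_itv /= lexx ler01.
have m0 := capacity_level_set 0 mg.
have S0 : 0 <= S 0 (mu [set x | 0 <= g x]).
  by have := semicopula_range hS i0 m0; rewrite in_itv => /andP[].
apply: (le_trans S0); apply: ub_le_sup; last by exists 0.
exists 1 => _ [t /= t01 <-].
by have := semicopula_range hS t01 (capacity_level_set t mg);
  rewrite in_itv => /andP[].
Qed.

Lemma sugeno_integral_le (g : T -> R) (c : R) :
  (forall t, t \in `[0, 1] -> S t (mu [set x | t <= g x]) <= c) ->
  sugeno_integral S mu g <= c.
Proof.
move=> h; apply: ge_sup; last by move=> _ [t /= t01 <-]; exact: h.
by exists (S 0 (mu [set x | 0 <= g x])), 0 => //=; rewrite in_itv /= lexx ler01.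
Qed.

(** Level sets at positive heights lie in the support, and [S] is below its
    second argument; the height [0] contributes nothing since [S] is also below
    its first argument. *)
Lemma sugeno_integral_le_support (g : T -> R) :
  measurable_fun [set: T] g ->
  sugeno_integral S mu g <= mu [set x | 0 < g x].
Proof.
move=> mg; have msupp := measurable_support_set mg.
apply: sugeno_integral_le => t t01; have mt := capacity_level_set t mg.
have [t0|t0] := leP t 0.
  apply: (le_trans (semicopula_le_arg1 hS t01 mt)); apply: (le_trans t0).
  by have := capacity_range hmu msupp; rewrite in_itv => /andP[].
apply: (le_trans (semicopula_le_arg2 hS t01 mt)).
apply: (capacity_le hmu) => //; first exact: measurable_level_set.
by move=> x /=; exact: lt_le_trans.
Qed.

(** Heights [t <= c] contribute at most [t]; above [c] the level set is empty
    and [S t 0 <= 0]. *)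
Lemma sugeno_integral_le_bound (g : T -> R) (c : R) :
  measurable_fun [set: T] g -> 0 <= c -> (forall x, g x <= c) ->
  sugeno_integral S mu g <= c.
Proof.
move=> mg c0 gc; apply: sugeno_integral_le => t t01.
have mt := capacity_level_set t mg.
have [tc|ct] := leP t c.
  exact: (le_trans (semicopula_le_arg1 hS t01 mt)).
apply: (le_trans (semicopula_le_arg2 hS t01 mt)).
rewrite (_ : [set x | _] = set0) ?(capacity_set0 hmu)//.
by apply/seteqP; split => x //=; rewrite leNgt (le_lt_trans (gc x) ct).
Qed.

End sugeno_bounds.

Lemma measurable_fun_dist (d : measure_display) (T : measurableType d)
    (R : realType) (f g : T -> R) :
  measurable_fun [set: T] f -> measurable_fun [set: T] g ->
  measurable_fun [set: T] (fun x => `|f x - g x|).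
Proof.
move=> mf mg; apply: measurableT_comp => //.
exact: measurable_realfun.measurable_funB.
Qed.

(** It suffices to dominate the integrals of [|f_n - f|], which are
    nonnegative, by a null sequence. *)
Lemma cvg_in_mean_squeeze (R : realType) (S : R -> R -> R)
    (d : measure_display) (T : measurableType d) (mu : set T -> R)
    (f : T -> R) (f_ : nat -> T -> R) (u : nat -> R) :
  semicopula S -> capacity mu ->
  measurable_unit f -> (forall n, measurable_unit (f_ n)) ->
  (forall n, sugeno_integral S mu (fun x => `|f_ n x - f x|) <= u n) ->
  u n @[n --> \oo] --> (0 : R) -> cvg_in_mean S mu f_ f.
Proof.
move=> hS hmu [mf _] mf_ Iu u0.
apply: (squeeze_cvgr _ (cvg_cst 0) u0); apply: nearW => n.
rewrite Iu andbT; apply: sugeno_integral_ge0 => //.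
by apply: measurable_fun_dist => //; have [] := mf_ n.
Qed.

Lemma cvg_strictly_in_mean (R : realType) (S : R -> R -> R)
    (d : measure_display) (T : measurableType d) (mu : set T -> R)
    (f : T -> R) (f_ : nat -> T -> R) :
  semicopula S -> capacity mu ->
  measurable_unit f -> (forall n, measurable_unit (f_ n)) ->
  cvg_strictly mu f_ f -> cvg_in_mean S mu f_ f.
Proof.
move=> hS hmu mf mf_; apply: cvg_in_mean_squeeze => // n.
apply: sugeno_integral_le_support => //.
by apply: measurable_fun_dist; [have [] := mf_ n | have [] := mf].
Qed.

Lemma capacity_indic (R : realType) (d : measure_display)
    (T : measurableType d) (a : T) : capacity (fun A : set T => \1_A a : R).
Proof.
split=> [A _|A B _ _ AB||].
- by rewrite in_itv /= indicE; case: (_ \in _); rewrite /= ?lexx ?ler01.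
- rewrite !indicE ler_nat; have [aA|//] := boolP (a \in A).
  by rewrite mem_set //; apply: AB; rewrite inE in aA.
- by rewrite indicE in_set0.
- by rewrite indicE in_setT.
Qed.

Theorem theorem2p2 (R : realType) (S : R -> R -> R) (hS : semicopula S) :
  (forall (d : measure_display) (T : measurableType d) (mu : set T -> R)
      (f : T -> R) (f_ : nat -> T -> R),
    capacity mu -> measurable_unit f -> (forall n, measurable_unit (f_ n)) ->
    cvg_strictly mu f_ f -> cvg_in_mean S mu f_ f) /\
  (exists (d : measure_display) (T : measurableType d) (mu : set T -> R)
      (f : T -> R) (f_ : nat -> T -> R),
    [/\ capacity mu, measurable_unit f, (forall n, measurable_unit (f_ n)),
        cvg_in_mean S mu f_ f & ~ cvg_strictly mu f_ f]).
Proof.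
split=> [d T mu f f_|]; first exact: cvg_strictly_in_mean.
pose f : unit -> R := cst 0.
pose f_ (n : nat) : unit -> R := cst n.+1%:R^-1.
pose mu (A : set unit) : R := \1_A tt.
have hmu : capacity mu by exact: capacity_indic.
have mf : measurable_unit f.
  by split=> [|x]; [exact: measurable_cst | rewrite in_itv /= lexx ler01].
have mf_ n : measurable_unit (f_ n).
  split=> [|x]; first exact: measurable_cst.
  by rewrite in_itv /= invr_ge0 ler0n /= invf_le1 ?ler1n ?ltr0n.
exists _, unit, mu, f, f_; split=> //.
  apply: (cvg_in_mean_squeeze hS hmu mf mf_ _ (@cvg_harmonic R)) => n.
  apply: sugeno_integral_le_bound => //.
  by move=> x; rewrite /f_ /f /= subr0 ger0_norm.
rewrite /cvg_strictly (_ : (fun n => mu _) = cst 1).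
  move=> /(cvg_lim (@Rhausdorff R)); rewrite lim_cst //.
  by move/eqP; rewrite oner_eq0.
apply/funext => n; rewrite -[RHS](capacity_setT hmu); congr mu.
apply/seteqP; split => // x _ /=.
by rewrite /f_ /f /= subr0 normr_gt0 invr_eq0 pnatr_eq0.
Qed.
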